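(* For all integers $m > n \ge 3$, $$\gamma_c(G(n,m)) = \gamma_c(G(n,m-1)) + \frac12\left(1+(-1)^m\right).$$
   Context: For integers $n,m\ge 1$, the grid $G(n,m)$ has cell set $V_{n,m}=\{(i,j): 1\le i\le n,\ 1\le j\le m\}$ ($i$ = row, $j$ = column). Contamination rules: a cell $u=(i,j)\in V_{n,m}$ can be contaminated by two contaminated cells $v,w\in V_{n,m}$ if one of the following holds: (a) $v=(i-1,j-1)$, $w=(i+1,j+1)$; (b) $v=(i+1,j-1)$, $w=(i-1,j+1)$; (c) $v=(i-1,j)$, $w=(i+1,j)$; (d) $v=(i,j-1)$, $w=(i,j+1)$; (e) $v=(i,j-1)$, $w=(i-1,j)$; (f) $v=(i,j-1)$, $w=(i+1,j)$; (g) $v=(i+1,j)$, $w=(i,j+1)$; (h) $v=(i-1,j)$, $w=(i,j+1)$. For $S\subseteq V_{n,m}$, the final contaminated set $C(S)$ is the smallest subset of $V_{n,m}$ containing $S$ and closed under rules (a)--(h). $S$ is a contaminating set if $C(S)=V_{n,m}$. The power contamination number $\gamma_c(G(n,m))$ is the minimum cardinality of a contaminating set. *)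

(* Defs.v *)
From mathcomp Require Import all_boot all_order all_algebra.

Set Implicit Arguments.
Unset Strict Implicit.
Unset Printing Implicit Defensive.

(* Rows and columns are numbered from 0 instead of 1; the contamination rules
   are invariant under this shift.  The first component is the row. *)
Definition cell (n m : nat) : finType := ('I_n * 'I_m)%type.

(* [at_offset u v a b c d] says that v = (i - a + b, j - c + d), where
   u = (i, j); it is written additively to avoid truncated subtraction. *)
Definition at_offset n m (u v : cell n m) (a b c d : nat) : bool :=
  (v.1 + a == u.1 + b) && (v.2 + c == u.2 + d).

Definition up_left    n m (u v : cell n m) := at_offset u v 1 0 1 0.
Definition up         n m (u v : cell n m) := at_offset u v 1 0 0 0.
Definition up_right   n m (u v : cell n m) := at_offset u v 1 0 0 1.
Definition left_of    n m (u v : cell n m) := at_offset u v 0 0 1 0.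
Definition right_of   n m (u v : cell n m) := at_offset u v 0 0 0 1.
Definition down_left  n m (u v : cell n m) := at_offset u v 0 1 1 0.
Definition down       n m (u v : cell n m) := at_offset u v 0 1 0 0.
Definition down_right n m (u v : cell n m) := at_offset u v 0 1 0 1.

(* [up u v] reads "v is the cell just above u", and so on: rows are numbered
   downwards and columns rightwards. *)
Definition can_contaminate n m (v w u : cell n m) : bool :=
  [|| up_left u v && down_right u w,
      down_left u v && up_right u w,
      up u v && down u w,
      left_of u v && right_of u w,
      left_of u v && up u w,
      left_of u v && down u w,
      down u v && right_of u w
    | up u v && right_of u w].

Definition contamination_closed n m (A : {set cell n m}) : bool :=
  [forall v in A, forall w in A, forall u,
     can_contaminate v w u ==> (u \in A)].

(* The smallest closed superset of S, as the intersection of all of them; see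
   [contaminated_least]. *)
Definition contaminated n m (S : {set cell n m}) : {set cell n m} :=
  \bigcap_(A : {set cell n m} | (S \subset A) && contamination_closed A) A.

Definition contaminating n m (S : {set cell n m}) : bool :=
  contaminated S == [set: cell n m].

(* The minimum exists because the full set is contaminating; see
   [power_contamination_min]. *)
Definition power_contamination (n m : nat) : nat :=
  #|[arg min_(S < [set: cell n m] | contaminating S) #|S| ]|.

Lemma contamination_closedP n m (A : {set cell n m}) :
  reflect (forall v w u, v \in A -> w \in A -> can_contaminate v w u -> u \in A)
          (contamination_closed A).
Proof.
apply: (iffP idP) => [cA v w u vA wA|cA].
  by move/forall_inP/(_ v vA)/forall_inP/(_ w wA)/forallP/(_ u)/implyP: cA.
apply/forall_inP => v vA; apply/forall_inP => w wA; apply/forallP => u.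
by apply/implyP; apply: cA.
Qed.

Lemma contaminated_least n m (S : {set cell n m}) :
  [/\ S \subset contaminated S, contamination_closed (contaminated S)
    & forall A : {set cell n m}, S \subset A -> contamination_closed A ->
        contaminated S \subset A].
Proof.
split.
- by apply/bigcapsP => A /andP[].
- apply/contamination_closedP => v w u /bigcapP vC /bigcapP wC cu.
  apply/bigcapP => A hA; have /andP[_ /contamination_closedP cA] := hA.
  exact: cA (vC A hA) (wC A hA) cu.
- by move=> A SA cA; apply: bigcap_inf; rewrite SA.
Qed.

Lemma contaminating_setT n m : contaminating [set: cell n m].
Proof.
by rewrite /contaminating eqEsubset subsetT; case: (contaminated_least [set: cell n m]).
Qed.

Lemma power_contamination_min n m :
  (exists2 S : {set cell n m}, contaminating S & #|S| = power_contamination n m)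
  /\ (forall S : {set cell n m}, contaminating S ->
        power_contamination n m <= #|S|).
Proof.
rewrite /power_contamination.
by case: arg_minnP => [|S cS minS]; [exact: contaminating_setT | split=> //; exists S].
Qed.

(* Main.v *)
Require Import Defs.
From mathcomp Require Import all_boot all_order all_algebra.
From mathcomp Require Import zify.

Set Implicit Arguments.
Unset Strict Implicit.
Unset Printing Implicit Defensive.

                                                                          
                                                                           
                                                                             
                                                                      
                                                                                
                                                                          
                     

Local Open Scope nat_scope.

(** For 3 <= n <= m the number equals floor(m/2) + 1 ([power_contaminationE]), so passing from m - 1
    to m adds one exactly when m is even. Lower bound ([contaminating_card_ge]): contamination
    cannot enter two adjacent empty columns, nor an empty border column. A contaminating set
    therefore meets the first column, the last column and one of any two neighbours, which forces
    floor(m/2) + 1 occupied columns. Upper bound ([contaminating_chain]): take (0,0), (2,2), (4,4),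
    ..., with coordinates clamped to the last row and the last column. A contaminated rectangle
    growing from (0,0) absorbs these cells one by one. *)

Lemma contaminatingP n m (S : {set cell n m}) :
  reflect (forall A : {set cell n m},
             S \subset A -> contamination_closed A -> A = [set: cell n m])
          (contaminating S).
Proof.
have [SC cC minC] := contaminated_least S.
apply: (iffP eqP) => [CT A SA cA|h]; last exact: h.
by apply/eqP; rewrite eqEsubset subsetT -CT minC.
Qed.

                                                                               
            
(** The complement of columns j - 1 and j is closed: every rule for a cell uses its own column, or
    both neighbouring columns, and one of these lies in the band or off the grid. The extreme values
    j = 0 and j = m leave a single border column. *)
Lemma contaminating_meets_columns n m (S : {set cell n m}) j :
  0 < n -> 0 < m -> contaminating S -> j <= m ->
  exists2 u, u \in S & (u.2 == j :> nat) || (u.2.+1 == j).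
Proof.
move=> n0 m0 /contaminatingP cS jm.
case: (pickP [pred u in S | (u.2 == j :> nat) || (u.2.+1 == j)]) => [u /andP[]|noS].
  by exists u.
pose A := [set u : cell n m | ~~ ((u.2 == j :> nat) || (u.2.+1 == j))].
have SA : S \subset A.
  by apply/subsetP => u uS; rewrite inE; have := noS u; rewrite /= uS /= => ->.
have cA : contamination_closed A.
  apply/contamination_closedP => v w u; rewrite !inE /can_contaminate.
  rewrite /up_left /up /up_right /left_of /right_of /down_left /down /down_right.
  rewrite /at_offset => vA wA /or4P[|||/or4P[|||/orP[]]] /andP[/andP[_ /eqP v2]];
    by move=> /andP[_ /eqP w2]; lia.
(* The predecessor is truncated: for j = 0 it gives column 0, so the removed band contains a cell in
   every case. *)
have j1m : j.-1 < m by lia.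
have /setP/(_ (Ordinal n0, Ordinal j1m)) := cS A SA cA.
by rewrite !inE /=; lia.
Qed.

(** The term [c k] strengthens the induction: a gap at the end is repaid by the next column, which
    must be occupied. An occupied last column then supplies the final + 1 of the bound. *)
Lemma leq_sum_no_two_gaps (c : nat -> bool) k :
  c 0 -> (forall j, j < k -> c j || c j.+1) ->
  k.+1 + c k <= (\sum_(j < k.+1) c j).*2.
Proof.
move=> c0; elim: k => [|k IHk] gaps; first by rewrite big_ord_recr big_ord0 /= c0.
have {}IHk : k.+1 + c k <= (\sum_(j < k.+1) c j).*2.
  by apply: IHk => j jk; apply: gaps; apply: ltnW.
rewrite big_ord_recr /=; move: (gaps k (ltnSn k)) IHk.
by case: (c k); case: (c k.+1) => //= _; lia.
Qed.

Lemma contaminating_card_ge n m (S : {set cell n m}) :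
  0 < n -> 0 < m -> contaminating S -> m./2.+1 <= #|S|.
Proof.
case: m S => // m S n0 _ cS.
pose c j := [exists u in S, u.2 == j :> nat].
(* At [j = 0] only the first disjunct can hold and at [j = m.+1] only the second, so both border
   columns are occupied. *)
have meet j : j <= m.+1 -> (j < m.+1) && c j || (0 < j) && c j.-1.
  move=> jm; have [u uS /orP[/eqP uj|/eqP uj]] :=
    @contaminating_meets_columns _ _ _ j n0 (ltn0Sn m) cS jm.
    by apply/orP; left; rewrite -uj ltn_ord; apply/exists_inP; exists u.
  by apply/orP; right; rewrite -uj /=; apply/exists_inP; exists u.
have c0 : c 0 by have := meet 0; rewrite /= orbF; apply.
have cm : c m by have := meet m.+1 (leqnn _); rewrite ltnn.
have gaps j : j < m -> c j || c j.+1.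
  by move=> jm; have := meet j.+1; rewrite /= orbC; lia.
have := leq_sum_no_two_gaps c0 gaps.
have <- : #|[set u.2 | u in S]| = \sum_(j < m.+1) c j.
  rewrite -sum1_card big_mkcond /=; apply: eq_bigr => j _.
  suff -> : (j \in [set u.2 | u in S]) = c j by case: (c j).
  apply/imsetP/exists_inP => -[u uS /eqP uj]; exists u => //.
    by rewrite eq_sym.
  exact/val_inj/esym.
rewrite cm => cols; apply: leq_trans (leq_imset_card (fun u => u.2) S).
by move: cols; rewrite /=; set d := #|_|; lia.
Qed.

(** Bounds are inclusive, and a predicate on all pairs of naturals keeps ordinals out of the growth
    argument. *)
Definition rect_in (P : nat -> nat -> Prop) r c :=
  forall i j, i <= r -> j <= c -> P i j.

(** Rules (e)-(h) on a 2x2 block: two opposite corners contaminate the other two. This form is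
    invariant under transposition. *)
Record corner_closed (P : nat -> nat -> Prop) := CornerClosed {
  corner_diag : forall i j, P i j -> P i.+1 j.+1 -> P i j.+1 /\ P i.+1 j;
  corner_anti : forall i j, P i.+1 j -> P i j.+1 -> P i j /\ P i.+1 j.+1 }.

Lemma corner_closed_tr P : corner_closed P -> corner_closed (fun i j => P j i).
Proof.
move=> [diag anti]; split=> i j Pa Pb; first by have [] := diag _ _ Pa Pb.
by have [] := anti _ _ Pb Pa.
Qed.

(** A contaminated cell of the new column and a cell of column c one row off are opposite corners of
    a 2x2 block. Contamination thus spreads up by [diag] and down by [anti]. *)
Lemma rect_add_column P r c i :
  corner_closed P -> rect_in P r c -> i <= r -> P i c.+1 -> rect_in P r c.+1.
Proof.
move=> [diag anti] rect ir Pi.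
have above d : d <= i -> P (i - d) c.+1.
  elim: d => [|d IHd] di; first by rewrite subn0.
  have Pd := IHd (ltnW di); rewrite -(subnSK di) in Pd.
  have dr : i - d.+1 <= r by lia.
  by have [] := diag _ _ (rect _ _ dr (leqnn c)) Pd.
have below d : i + d <= r -> P (i + d) c.+1.
  elim: d => [|d IHd] dr; first by rewrite addn0.
  have Pd : P (i + d) c.+1 by apply: IHd; lia.
  rewrite addnS in dr *.
  by have [] := anti (i + d) c (rect _ _ dr (leqnn c)) Pd.
move=> a b ar; rewrite leq_eqVlt => /predU1P[->|bc]; last exact: rect.
have [ai|ia] := leqP a i; first by have := above (i - a) (leq_subr _ _); rewrite subKn.
by have := below (a - i); rewrite subnKC; [apply|exact: ltnW].
Qed.

Lemma rect_add_row P r c j :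
  corner_closed P -> rect_in P r c -> j <= c -> P r.+1 j -> rect_in P r.+1 c.
Proof.
move=> /corner_closed_tr cP rect jc Pj a b ar bc.
have trect : rect_in (fun i k => P k i) c r by move=> i k ic kr; exact: rect.
exact: (rect_add_column cP trect jc Pj).
Qed.

Lemma rect_add_corner P r c :
  corner_closed P -> rect_in P r c -> P r.+1 c.+1 -> rect_in P r.+1 c.+1.
Proof.
move=> cP rect Pc; have [Pr _] := corner_diag cP (rect r c (leqnn _) (leqnn _)) Pc.
have rect' := rect_add_column cP rect (leqnn r) Pr.
exact: rect_add_row cP rect' (leqnn _) Pc.
Qed.

Section Absorption.

Variable P : nat -> nat -> Prop.
Hypothesis cP : corner_closed P.
Hypothesis skip_diag : forall i j, P i j -> P i.+2 j.+2 -> P i.+1 j.+1.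
Hypothesis skip_row : forall i j, P i j -> P i j.+2 -> P i j.+1.

Lemma rect_absorb_22 r c : rect_in P r c -> P r.+2 c.+2 -> rect_in P r.+2 c.+2.
Proof.
move=> rect Pc; apply: rect_add_corner => //; apply: rect_add_corner => //.
by apply: skip_diag => //; apply: rect.
Qed.

                                                                               
                                          
(** The new cell is two diagonal steps from (r, c), which lies one row above the rectangle's corner.
    The rectangle must therefore have at least two rows, which is where three rows in the grid come
    in. *)
Lemma rect_absorb_12 r c :
  rect_in P r.+1 c -> P r.+2 c.+2 -> rect_in P r.+2 c.+2.
Proof.
move=> rect Pc; apply: rect_add_corner => //.
apply: (rect_add_column cP rect (leqnn _)).
by apply: skip_diag => //; apply: rect.
Qed.

Lemma rect_absorb_02 r c : rect_in P r c -> P r c.+2 -> rect_in P r c.+2.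
Proof.
move=> rect Pc; apply: (rect_add_column cP _ (leqnn _) Pc).
apply: (rect_add_column cP rect (leqnn _)).
by apply: skip_row => //; apply: rect.
Qed.

(** Induction on the number of absorbed cells, the rectangle ending at the latest one. Clamping
    leaves the jumps (2,2), (1,2), (0,2), and (1,1) or (0,1) at the last column. *)
Lemma rect_absorb_chain n m :
  2 <= n -> n <= m ->
  (forall k, k <= m.+1./2 -> P (minn k.*2 n) (minn k.*2 m)) ->
  rect_in P n m.
Proof.
move=> n2 nm start.
suff rect k : k <= m.+1./2 -> rect_in P (minn k.*2 n) (minn k.*2 m).
  by have := rect _ (leqnn _); rewrite !(minn_idPr _) //; lia.
elim: k => [|k IHk] km.
  have P00 := start 0 isT; rewrite double0 !min0n in P00 *.
  by move=> i j; rewrite !leqn0 => /eqP-> /eqP->.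
have {IHk} := IHk (ltnW km); have := start _ km.
have [k2m|mk2] := boolP (k.*2.+2 <= m); last first.
  (* Here m = 2k + 1, so the last jump advances a single column. *)
  have -> : minn k.+1.*2 m = k.*2.+1 by lia.
  have -> : minn k.*2 m = k.*2 by lia.
  have [nm'|nm'] := boolP (n <= k.*2).
    have -> : minn k.+1.*2 n = n by lia.
    have -> : minn k.*2 n = n by lia.
    by move=> Pc rect; exact: rect_add_column cP rect (leqnn _) Pc.
  have -> : minn k.+1.*2 n = k.*2.+1 by lia.
  have -> : minn k.*2 n = k.*2 by lia.
  by move=> Pc rect; exact: rect_add_corner.
have -> : minn k.+1.*2 m = k.*2.+2 by lia.
have -> : minn k.*2 m = k.*2 by lia.
have [k2n|nk2] := boolP (k.*2.+2 <= n).
  have -> : minn k.+1.*2 n = k.*2.+2 by lia.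
  have -> : minn k.*2 n = k.*2 by lia.
  by move=> Pc rect; exact: rect_absorb_22.
have [nk|kn] := boolP (n <= k.*2).
  have -> : minn k.+1.*2 n = n by lia.
  have -> : minn k.*2 n = n by lia.
  by move=> Pc rect; exact: rect_absorb_02.
(* Here n = 2k + 1, and 2 <= n forces k > 0, so [k.*2.-1] is a genuine predecessor. *)
have -> : minn k.+1.*2 n = k.*2.-1.+2 by lia.
have -> : minn k.*2 n = k.*2.-1.+1 by lia.
by move=> Pc rect; exact: rect_absorb_12.
Qed.

End Absorption.

(** The grid has [m.+1] columns, so the size of the index type is exactly the lower bound. *)
Definition chain n m : {set cell n.+1 m.+1} :=
  [set (inord (minn k.*2 n), inord (minn k.*2 m)) | k : 'I_(m.+1./2.+1)].

Lemma contaminating_chain n m :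
  2 <= n -> n <= m -> contaminating (chain n m).
Proof.
move=> n2 nm; apply/contaminatingP => A chainA /contamination_closedP cA.
pose P i j := exists2 u, u \in A & (u.1 = i :> nat) /\ (u.2 = j :> nat).
have bounds i j : P i j -> i < n.+1 /\ j < m.+1.
  by case=> u _ [<- <-]; split; exact: ltn_ord.
(* Transfers a contamination rule from cells to [P]; only the target's coordinates need a bound
   check. *)
have rule i j i' j' a b : P i j -> P i' j' -> a < n.+1 -> b < m.+1 ->
    (forall v w u : cell n.+1 m.+1,
       (v.1 = i :> nat) * (v.2 = j :> nat) -> (w.1 = i' :> nat) * (w.2 = j' :> nat) ->
       (u.1 = a :> nat) * (u.2 = b :> nat) -> can_contaminate v w u) -> P a b.
  move=> [v vA [vi vj]] [w wA [wi wj]] an bm h.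
  by exists (Ordinal an, Ordinal bm) => //; apply: cA vA wA (h _ _ _ _ _ _).
have PT : rect_in P n m.
  apply: rect_absorb_chain => // [|i j Pa Pb|i j Pa Pb|k km].
  - split=> i j Pa Pb; have [? ?] := bounds _ _ Pa; have [? ?] := bounds _ _ Pb;
      split; apply: (rule _ _ _ _ _ _ Pa Pb) => // v w u vE wE uE;
      rewrite /can_contaminate /left_of /up /down /right_of /at_offset !(vE, wE, uE);
      by rewrite !addn0 !addn1 !eqxx /= ?orbT.
  - have [? ?] := bounds _ _ Pb.
    apply: (rule _ _ _ _ _ _ Pa Pb) => [||v w u vE wE uE]; try exact: ltnW.
    rewrite /can_contaminate /up_left /down_right /at_offset !(vE, wE, uE).
    by rewrite !addn0 !addn1 !eqxx.
  - have [? ?] := bounds _ _ Pb.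
    apply: (rule _ _ _ _ _ _ Pa Pb) => [||v w u vE wE uE] //; try exact: ltnW.
    rewrite /can_contaminate /left_of /right_of /at_offset !(vE, wE, uE).
    by rewrite !addn0 !addn1 !eqxx /= ?orbT.
  exists (inord (minn k.*2 n), inord (minn k.*2 m)).
    apply: (subsetP chainA); apply/imsetP; exists (inord k) => //.
    by rewrite inordK.
  by rewrite /= !inordK // ltnS geq_minr.
apply/setP => -[u1 u2]; rewrite inE.
have [|| [v1 v2] vA [/= e1 e2]] := PT u1 u2; try by rewrite -ltnS ltn_ord.
by rewrite -(val_inj e1) -(val_inj e2).
Qed.

Lemma power_contaminationE n m :
  3 <= n -> n <= m -> power_contamination n m = m./2.+1.
Proof.
move=> n3 nm; have [[S cS <-] minS] := power_contamination_min n m.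
apply/eqP; rewrite eqn_leq contaminating_card_ge ?andbT //; try lia.
case: n m n3 nm S cS minS => // n [//|m] n3 nm S cS minS.
apply: leq_trans (minS _ (@contaminating_chain n m n3 nm)) _.
by apply: leq_trans (leq_imset_card _ _) _; rewrite cardE size_enum_ord.
Qed.

Local Open Scope ring_scope.

Theorem corollary3 (n m : nat) (hn : (3 <= n)%N) (hnm : (n < m)%N) :
  (power_contamination n m)%:R
  = (power_contamination n (m - 1))%:R + 1 / 2 * (1 + (-1) ^+ m) :> rat.
Proof.
(* The strict inequality n < m gives n <= m - 1, so the closed formula applies on both sides. *)
rewrite !power_contaminationE //; try lia.
(* From here [m] is the predecessor: the two halves differ by its parity bit, which is 1 exactly
   when the original width is even. *)
case: m hnm => // m _; rewrite subn1 -GRing.signr_odd /= uphalf_half.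
case: (odd m); last by rewrite add0n GRing.subrr GRing.mulr0 GRing.addr0.
by rewrite add1n -[in LHS]addn1 GRing.natrD.
Qed.
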